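(* Let $G=(V,E)$ be a finite simple undirected graph, let $V_C\subseteq V$ be non-empty, let $C=(V_C,E_C)$ be the subgraph of $G$ induced by $V_C$ (the core), and let $P=(V_P,E_P)$ be the graph obtained from $G$ by contracting $C$ into one vertex (the periphery), where $E_P$ is identified with $E\setminus E_C$. Assume that $P$ is a tree. Let $A$ and $B$ be disjoint sets, let $e\mapsto[e]_C\subseteq A$ be a labelling of the edges $e \in E_C$ of $C$, and let $e\mapsto[e]_P\subseteq B$ be a labelling of the edges $e\in E_P$ of $P$. Assume that for every shortest path in $C$ the labelling $[\cdot]_C$ has no false positives in $E_C$, and that for every shortest path in $P$ the labelling $[\cdot]_P$ has no false positives in $E_P$. Define the combined labelling of the edges of $G$, with universal set $A\cup B$, by $[e]=[e]_C$ if $e\in E_C$ and $[e]=[e]_P$ if $e\in E_P$. Then for every shortest path in $G$, with edge set $S$, the combined labelling has no false positives; that is, there is no edge $f\in E$ with $f\notin S$ and $[f]\subseteq[S]$.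
   Context: A labelling of the edges of a graph with edge set $E$ and universal set $U$ assigns to each edge $e\in E$ a subset $[e]\subseteq U$; for $S\subseteq E$ one puts $[S]=\bigcup_{e\in S}[e]$ (so $[\emptyset]=\emptyset$). A false positive for $S\subseteq E$ is an edge $f\in E$ such that $f\notin S$ but $[f]\subseteq[S]$. A shortest path from $u$ to $v$ in a graph is a path from $u$ to $v$ in that graph with the minimum possible number of edges; it is identified with its set of edges, and paths with $0$ edges are allowed (as shortest paths from a vertex to itself). Contracting $C$ into one vertex means: all vertices of $V_C$ are replaced by a single new vertex $c$, so $V_P=(V\setminus V_C)\cup\{c\}$; the edges in $E_C$ are removed; and every other edge of $G$ is kept, with each end vertex lying in $V_C$ replaced by $c$. Thus the edges of $P$ correspond one-to-one to $E\setminus E_C$; parallel edges are kept as distinct edges, so the assumption that $P$ is a tree implies in particular that $P$ has no parallel edges. *)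

(* Defs.v *)
From mathcomp Require Import classical_sets.
(* finset comes after classical_sets so that [set0], [setT], ... denote finite
   sets; sets of labels are classical sets, possibly infinite. *)
From mathcomp Require Import all_boot.

Set Implicit Arguments.
Unset Strict Implicit.
Unset Printing Implicit Defensive.

(* Undirected multigraphs. [ends f] is the set of end vertices of the edge [f]:
   a singleton for a loop, a pair otherwise. The value of [ends] outside
   [edges] is irrelevant. *)
Record mgraph (V E : finType) := MGraph {
  verts : {set V};
  edges : {set E};
  ends : E -> {set V}
}.

(* A simple graph on the vertex type [T], whose edges are 2-element sets. *)
Definition simple_graph (T : finType) (E : {set {set T}}) : mgraph T {set T} :=
  MGraph [set: T] E id.

Section Multigraph.
Variables (V E : finType).
Implicit Types (g : mgraph V E) (u v : V) (p q : seq (E * V)).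

(* A walk from [u] is the sequence of its steps (f, w), where [f] is the edge
   traversed and [w] the vertex reached. *)
Fixpoint walk g u v p : bool :=
  match p with
  | [::] => (u \in verts g) && (u == v)
  | (f, w) :: p' =>
      [&& u \in verts g, f \in edges g, ends g f == [set u; w] & walk g w v p']
  end.

Definition walk_edges p : {set E} := [set f in map fst p].

Definition is_path g u v p : bool := walk g u v p && uniq (u :: map snd p).

Definition shortest_path g u v p : Prop :=
  is_path g u v p /\ forall q, is_path g u v q -> size p <= size q.

Definition connected g : Prop :=
  (exists u, u \in verts g) /\
  forall u v, u \in verts g -> v \in verts g -> exists p, is_path g u v p.

(* Loops are cycles of length 1, pairs of parallel edges cycles of length 2. *)
Definition is_cycle g u p : bool :=
  [&& p != [::], walk g u u p, uniq (map snd p) & uniq (map fst p)].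

Definition acyclic g : Prop := forall u p, ~~ is_cycle g u p.

Definition tree g : Prop := connected g /\ acyclic g.

Definition induced g (W : {set V}) : mgraph V E :=
  MGraph W [set f in edges g | ends g f \subset W] (ends g).

Definition contract_vertex (W : {set V}) (x : V) : option V :=
  if x \in W then None else Some x.

(* [None] is the new vertex; the edges keep their identity, so parallel edges
   may arise. *)
Definition contract g (W : {set V}) : mgraph (option V) E :=
  MGraph (None |: [set Some x | x in verts g :\: W])
         (edges g :\: edges (induced g W))
         (fun f => [set contract_vertex W x | x in ends g f]).

End Multigraph.

Section Labelling.
Variables (E : finType) (U : Type).
Implicit Types (lab : E -> set U) (S : {set E}).

Definition label_set lab S : set U := (\bigcup_(f in [set` S]) lab f)%classic.

Definition false_positive (F : {set E}) lab S (f : E) : Prop :=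
  [/\ f \in F, f \notin S & (lab f `<=` label_set lab S)%classic].

Definition no_false_positives (F : {set E}) lab S : Prop :=
  forall f, ~ false_positive F lab S f.

Definition combined_labelling (F : {set E}) lab1 lab2 : E -> set U :=
  fun f => if f \in F then lab1 f else lab2 f.

End Labelling.

(* Main.v *)
(* Let [p] be a shortest path of [G]. A walk of an acyclic graph in which
   consecutive edges differ is a path, and is the only path between its ends.
   The edges of [p] outside the core form a walk of [P] without repeated edges,
   hence a shortest path of [P]. Between the first and the last visit of [p] to
   the core, the same argument yields a closed walk of [P] without repeated
   edges, which must be empty: so [p] visits the core in one contiguous stretch,
   which is a shortest path of [C] because it could be replaced by any other
   path of [C] with the same ends. As [A] and [B] are disjoint, a false positive
   for [p] would be one for the corresponding part of [p]. *)
Require Import Defs.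
From mathcomp Require Import classical_sets.
From mathcomp Require Import all_boot.

Set Implicit Arguments.
Unset Strict Implicit.
Unset Printing Implicit Defensive.

(** * Walks, reduced walks and uniqueness of paths in acyclic multigraphs *)

Section Walks.
Variables (V E : finType) (g : mgraph V E).
Implicit Types (u v w x : V) (f : E) (p q : seq (E * V)) (W : {set V}).

Lemma walk_src u v p : walk g u v p -> u \in verts g.
Proof. by case: p => [|[f w] p] /= => [/andP[]|/and4P[]]. Qed.

Lemma walk_cat u w v p q : walk g u w p -> walk g w v q -> walk g u v (p ++ q).
Proof.
elim: p u => [|[f x] p IHp] u /= => [/andP[_ /eqP ->] //|].
by case/and4P=> -> -> -> /IHp.
Qed.

Lemma walk_edgesS u v p : walk g u v p -> walk_edges p \subset edges g.
Proof.
move=> Hp; apply/subsetP=> f; rewrite inE.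
elim: p u Hp => [//|[f' w] p IHp] u /= /and4P[_ Hf' _ /IHp Hp].
by rewrite inE => /predU1P[->|/Hp].
Qed.

Lemma walk_ends_sub u v p f x :
  walk g u v p -> f \in map fst p -> x \in ends g f -> x \in u :: map snd p.
Proof.
move=> + + Hx; elim: p u => [//|[f' w] p IHp] u /= /and4P[_ _ /eqP Ef Hp].
rewrite inE => /predU1P[Eff'|/(IHp _ Hp) Hin].
  by move: Hx; rewrite Eff' Ef !inE => /orP[->//|->]; rewrite orbT.
by rewrite inE Hin orbT.
Qed.

(** An edge that recurs would bring the walk back to both of its ends, among them the vertex from
    which it was first traversed. *)
Lemma is_path_uniq_edges u v p : is_path g u v p -> uniq (map fst p).
Proof.
elim: p u => [//|[f w] p IHp] u /andP[/= /and4P[_ _ /eqP Ef Hp]].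
case/andP=> Hu Huniq; rewrite (IHp w) ?andbT; last by rewrite /is_path Hp.
by apply: contra Hu => Hf; apply: (walk_ends_sub Hp Hf); rewrite Ef set21.
Qed.

(** The use of [belast] leaves out the end [x] of [a], the one vertex of [a] that lies in [W]. *)
Lemma walk_first W u v p : walk g u v p -> has (mem W) (u :: map snd p) ->
  exists x a b, [/\ p = a ++ b, walk g u x a, walk g x v b, x \in W
    & ~~ has (mem W) (belast u (map snd a))].
Proof.
elim: p u => [|[f w] p IHp] u Hw Hhas.
  exists u, [::], [::]; split=> //.
    by rewrite /= eqxx (walk_src Hw).
  by move: Hhas; rewrite /= orbF.
have [HuW|HuW] := boolP (u \in W).
  by exists u, [::], ((f, w) :: p); split=> //; rewrite /= eqxx (walk_src Hw).
move: Hw Hhas; rewrite [has _ _]/= (negPf HuW) => /and4P[Hu Hf Ef Hp].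
case/(IHp w Hp) => x [a] [b] [-> Ha Hb Hx Hna].
exists x, ((f, w) :: a), b; split=> //=; first by rewrite Hu Hf Ef.
by rewrite negb_or HuW.
Qed.

Lemma walk_last W u v p : walk g u v p -> has (mem W) (u :: map snd p) ->
  exists y b c, [/\ p = b ++ c, walk g u y b, walk g y v c, y \in W
    & ~~ has (mem W) (map snd c)].
Proof.
elim: p u => [|[f w] p IHp] u Hw Hhas.
  exists u, [::], [::]; split=> //.
    by rewrite /= eqxx (walk_src Hw).
  by move: Hhas; rewrite /= orbF.
have [Hp|Hp] := boolP (has (mem W) (w :: map snd p)).
  move: Hw => /and4P[Hu Hf Ef /IHp/(_ Hp)[y] [b] [c] [-> Hb Hc Hy Hnc]].
  by exists y, ((f, w) :: b), c; split=> //=; rewrite Hu Hf Ef.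
exists u, [::], ((f, w) :: p); split=> //.
  by rewrite /= eqxx (walk_src Hw).
by move: Hhas; rewrite [has _ _]/= -[(w \in W) || _]/(has _ (w :: _))
     (negPf Hp) orbF.
Qed.

Lemma walk_closed_sub u v p : walk g u v p -> ~~ uniq (u :: map snd p) ->
  exists x a b c, [/\ p = a ++ b ++ c, walk g x x b & b != [::]].
Proof.
elim: p u => [//|[f w] p IHp] u Hw.
have [Hu _|Hu] := boolP (u \in map snd ((f, w) :: p)); last first.
  rewrite [uniq _]/= Hu => Hn; case/and4P: Hw => _ _ _ Hp.
  have [x [a [b [c [-> Hb b0]]]]] := IHp _ Hp Hn.
  by exists x, ((f, w) :: a), b, c.
case/and4P: Hw => Huv Hf Ef Hp.
(* The first return to [u] closes the walk; it is located by splitting at the singleton of [u]. *)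
have Hhas : has (mem [set u]) (w :: map snd p).
  by apply/hasP; exists u; rewrite //= inE.
have [x [a [b [-> Ha Hb]]]] := walk_first Hp Hhas.
rewrite inE => /eqP Ex _; rewrite {x}Ex in Ha Hb.
by exists u, [::], ((f, w) :: a), b; split=> //=; rewrite Huv Hf Ef.
Qed.

(** Walks without backtracking. The condition is local: segments inherit it, and a concatenation
    only has to be checked at the junction. *)
Definition reduced p := sorted [rel f f' : E | f != f'] (map fst p).

Lemma uniq_reduced p : uniq (map fst p) -> reduced p.
Proof.
rewrite /reduced; case: p => [//|[f w] p] /=.
elim: p f {w} => [//|[f' w] p IHp] f /=.
rewrite inE negb_or -andbA => /and3P[Hff' _ Hp].
by rewrite Hff' IHp.
Qed.

Lemma reduced_infix a b c : reduced (a ++ b ++ c) -> reduced b.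
Proof.
rewrite /reduced !map_cat => H.
have /= := drop_sorted (size (map fst a)) H; rewrite drop_size_cat // => H'.
by have /= := take_sorted (size (map fst b)) H'; rewrite take_size_cat.
Qed.

(** A step records the vertex it reaches, so in the reversed walk each edge is paired with the
    vertex it used to leave. *)
Fixpoint rev_walk u p :=
  if p is (f, w) :: p' then rcons (rev_walk w p') (f, u) else [::].

Lemma fst_rev_walk u p : map fst (rev_walk u p) = rev (map fst p).
Proof.
by elim: p u => [//|[f w] p IHp] u /=; rewrite map_rcons IHp rev_cons.
Qed.

Lemma walk_rev u v p : walk g u v p -> walk g v u (rev_walk u p).
Proof.
elim: p u => [|[f w] p IHp] u /= => [/andP[Hu /eqP <-]|].
  by rewrite Hu /=.
case/and4P=> Hu Hf Ef Hp; rewrite -cats1; apply: walk_cat (IHp _ Hp) _.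
by rewrite /= (walk_src Hp) Hf setUC Ef Hu eqxx.
Qed.

Hypothesis acyclic_g : acyclic g.

(** Strong induction on the length. If no vertex repeats after the first step, a non-empty walk of
    this kind is a cycle; otherwise it contains a shorter non-empty closed segment, which is again
    reduced. *)
Lemma closed_reduced_nil u p : walk g u u p -> reduced p -> p = [::].
Proof.
have [n] := ubnP (size p); elim: n p u => // n IHn [//|[f w] p] u /= le_p.
move=> Hw Hred; exfalso; have /and4P[Hu Hf /eqP Ef Hp] := Hw.
have [Huniq|Hn] := boolP (uniq (w :: map snd p)).
  have /negP[] := acyclic_g u ((f, w) :: p).
  apply/and4P; split=> //; apply/andP; split; last first.
    by apply: (@is_path_uniq_edges w u); rewrite /is_path Hp.
  (* The edge [f] does not recur: the next edge differs from it by reducedness, and a later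
     occurrence would revisit its end [w]. *)
  case: p {le_p Hw} Hred Hp Huniq => [//|[f' x] p].
  case/andP=> /= Hff' _ /and4P[_ _ _ Hp] /andP[Hw _].
  rewrite inE negb_or Hff'; apply: contra Hw => Hfp.
  by apply: walk_ends_sub Hp Hfp _; rewrite Ef set22.
have [x [a [b [c [Ep Hb]]]]] := walk_closed_sub Hp Hn.
rewrite (IHn b x) //.
  by apply: (@leq_ltn_trans (size p)); rewrite // Ep !size_cat addnCA leq_addr.
by apply: (@reduced_infix ((f, w) :: a) b c); rewrite cat_cons -Ep.
Qed.

Lemma reduced_is_path u v p : walk g u v p -> reduced p -> is_path g u v p.
Proof.
move=> Hp Hred; rewrite /is_path Hp; apply: contraT.
case/(walk_closed_sub Hp)=> x [a] [b] [c] [Ep Hb].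
by rewrite (closed_reduced_nil Hb) //; apply: (@reduced_infix a b c); rewrite -Ep.
Qed.

(** After the common initial edges are stripped, the reverse of one path followed by the other is a
    closed reduced walk, hence empty. *)
Lemma is_path_unique u v p q : is_path g u v p -> is_path g u v q -> p = q.
Proof.
elim: p u q => [|[f w] p IHp] u q Hp Hq.
  have /andP[/andP[_ /eqP Euv] _] := Hp; rewrite -Euv in Hq.
  apply/esym/(closed_reduced_nil (proj1 (andP Hq)))/uniq_reduced.
  exact: is_path_uniq_edges Hq.
have Rp := uniq_reduced (is_path_uniq_edges Hp).
have Rq := uniq_reduced (is_path_uniq_edges Hq).
have /andP[Wp /andP[Up Up']] := Hp; have /andP[Wq Uq] := Hq.
case: q Hq Rq Wq Uq => [|[f' w'] q] Hq Rq Wq Uq.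
  have Euv : u = v by case/andP: Wq => _ /eqP.
  by rewrite -Euv in Wp; have := closed_reduced_nil Wp Rp.
have [Eff'|Nff'] := eqVneq f f'.
  case/and4P: Wp => _ _ /eqP Ef Wp; case/and4P: Wq => _ _ /eqP Ef' Wq.
  case/andP: Uq => Uq Uq'.
  (* The shared edge is not a loop, since [w = u] would repeat the vertex [u] on the path. *)
  have Eww' : w = w'.
    have : w \in [set u; w'] by rewrite -Ef' -Eff' Ef set22.
    rewrite !inE => /predU1P[Ewu|/eqP //].
    by move: Up; rewrite -Ewu /= inE eqxx.
  by rewrite -Eff' -Eww' (IHp w q) //; apply/andP; split; rewrite // Eww'.
have Hcl := walk_cat (walk_rev Wq) Wp.
(* Each half is reduced, and at the junction [f'] meets [f], which differs from it. *)
suff Hred : reduced (rev_walk u ((f', w') :: q) ++ (f, w) :: p).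
  by have := congr1 size (closed_reduced_nil Hcl Hred); rewrite size_cat addnS.
rewrite /reduced map_cat fst_rev_walk [map _ _]/= [map fst (_ :: p)]/= rev_cons.
rewrite cat_rcons; rewrite sorted_cat_cons -rev_cons rev_sorted /= eq_sym Nff'.
rewrite (eq_path (e' := [rel x y | x != y])); last by move=> x y; rewrite /= eq_sym.
exact/andP.
Qed.

End Walks.

(** * Contracting the core, and the traces of a path in core and periphery *)

Section Contraction.
Variables (V E : finType) (g : mgraph V E) (W : {set V}).
Implicit Types (u v w x : V) (f : E) (p q : seq (E * V)).

Let C := induced g W.
Let P := contract g W.

Lemma contract_vertex_in x : x \in W -> contract_vertex W x = None.
Proof. by rewrite /contract_vertex => ->. Qed.

Lemma contract_vertex_verts x : x \in verts g -> contract_vertex W x \in verts P.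
Proof.
move=> Hx; rewrite /contract_vertex; case: ifP => HxW; rewrite !inE //=.
by rewrite imset_f // inE HxW.
Qed.

Definition contract_walk p : seq (E * option V) :=
  [seq (e.1, contract_vertex W e.2) | e <- p & e.1 \notin edges C].

(** Dropping a core edge leaves no gap, because both its ends become [None]. *)
Lemma walk_contract u v p : walk g u v p ->
  walk P (contract_vertex W u) (contract_vertex W v) (contract_walk p).
Proof.
elim: p u => [|[f w] p IHp] u /=.
  by case/andP=> /contract_vertex_verts -> /eqP ->; rewrite /=.
case/and4P=> Hu Hf /eqP Ef /IHp Hp.
have [HfC|HfC] := boolP (f \in edges C); rewrite /contract_walk /= HfC /=.
  move: HfC; rewrite inE Ef subUset !sub1set => /and3P[_ HuW HwW].
  by rewrite (contract_vertex_in HuW) -(contract_vertex_in HwW).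
rewrite contract_vertex_verts // in_setD HfC Hf Ef imsetU1 imset_set1 eqxx.
exact: Hp.
Qed.

Lemma fst_contract_walk p :
  map fst (contract_walk p) = [seq f <- map fst p | f \notin edges C].
Proof. by rewrite /contract_walk -map_comp filter_map. Qed.

Lemma walk_edges_contract p :
  walk_edges (contract_walk p) = walk_edges p :\: edges C.
Proof. by apply/setP=> f; rewrite !inE fst_contract_walk mem_filter !inE. Qed.

(** The contracted walk might still pass through [None] several times, so reducedness is derived
    from the distinctness of its edges. *)
Lemma contract_walk_reduced u v p : is_path g u v p -> reduced (contract_walk p).
Proof.
move/is_path_uniq_edges=> Hp; apply: uniq_reduced.
by rewrite fst_contract_walk filter_uniq.
Qed.

Lemma walk_last_vertex u v p : walk g u v p -> last u (map snd p) = v.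
Proof.
elim: p u => [|[f w] p IHp] u /= => [/andP[_ /eqP]|] //.
by case/and4P=> _ _ _ /IHp.
Qed.

Lemma walk_vertices_cat u x a b : walk g u x a ->
  u :: map snd (a ++ b) = belast u (map snd a) ++ x :: map snd b.
Proof.
by move=> Ha; rewrite map_cat -cat_cons lastI (walk_last_vertex Ha) cat_rcons.
Qed.

(** This form lists the junction [x] only once, which allows one segment of a path to be exchanged
    for another. *)
Lemma is_path_uniq u x v a b : walk g u x a -> walk g x v b ->
  is_path g u v (a ++ b) = uniq (belast u (map snd a) ++ x :: map snd b).
Proof.
by move=> Ha Hb; rewrite /is_path (walk_cat Ha Hb) (walk_vertices_cat _ Ha).
Qed.

Lemma walk_to_induced x y q :
  walk g x y q -> x \in W -> map fst q \subset edges C -> walk C x y q.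
Proof.
elim: q x => [|[f w] q IHq] x /= => [/andP[_ ->] ->|] //.
case/and4P=> _ _ /eqP Ef Hq Hx Hsub.
have HfC : f \in edges C by apply: (subsetP Hsub); rewrite inE eqxx.
have Hw : w \in W by move: HfC; rewrite inE Ef subUset !sub1set => /and3P[].
rewrite [f \in _]HfC Hx Ef eqxx IHq //.
by apply: subset_trans Hsub; apply/subsetP=> f' Hf'; rewrite inE Hf' orbT.
Qed.

Lemma walk_induced_verts x y q : walk C x y q -> all (mem W) (x :: map snd q).
Proof.
elim: q x => [|[f w] q IHq] x /= => [/andP[->]|] //.
by case/and4P=> -> _ _ /IHq.
Qed.

(** One end outside [W] keeps an edge out of the core. The two alternatives fit the stretch before
    the first visit to [W] and the stretch after the last one. *)
Lemma walk_edges_outside x y p : walk g x y p ->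
  ~~ has (mem W) (belast x (map snd p)) || ~~ has (mem W) (map snd p) ->
  [disjoint walk_edges p & edges C].
Proof.
rewrite disjoint_subset => Hp Hout; apply/subsetP=> f; rewrite inE => Hf.
rewrite -[_ \in _]/(f \notin edges C).
elim: p x Hp Hout Hf => [|[f' w] p IHp] x //=.
case/and4P=> Hx Hf' /eqP Ef /IHp Hp; rewrite !negb_or => Hout.
rewrite in_cons => /predU1P[->|].
  rewrite inE Ef subUset !sub1set Hf' /=.
  by case/orP: Hout => /andP[/negPf-> _]; rewrite ?andbF.
apply: Hp; case/orP: Hout => /andP[_ Hout]; apply/orP; [left|by right].
by move: Hout; case: (p).
Qed.

Hypothesis sWg : W \subset verts g.

Lemma walk_from_induced x y q : walk C x y q -> walk g x y q.
Proof.
elim: q x => [|[f w] q IHq] x /= => [/andP[/(subsetP sWg) -> ->]|] //.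
by case/and4P=> /(subsetP sWg) -> /setIdP[-> _] -> /IHq.
Qed.

Lemma walk_edges_cat p q : walk_edges (p ++ q) = walk_edges p :|: walk_edges q.
Proof. by apply/setP=> f; rewrite !inE map_cat mem_cat. Qed.

Hypothesis acyclic_P : acyclic P.

(** In an acyclic graph a path has no competitor, so being a path suffices for minimality. *)
Lemma shortest_path_contract u v p : is_path g u v p ->
  shortest_path P (contract_vertex W u) (contract_vertex W v) (contract_walk p).
Proof.
move=> Hp; have Hq : is_path P (contract_vertex W u) (contract_vertex W v)
  (contract_walk p).
  have /walk_contract := proj1 (andP Hp).
  by move/(reduced_is_path acyclic_P); apply; apply: contract_walk_reduced Hp.
by split=> // q /(is_path_unique acyclic_P Hq) ->.
Qed.

Lemma shortest_path_induced u v p : W != set0 -> shortest_path g u v p ->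
  exists x y q, shortest_path C x y q /\ walk_edges q = walk_edges p :&: edges C.
Proof.
case/set0Pn=> x0 Hx0 [Hp Hmin]; have /andP[Wp _] := Hp.
have [HasW|HasW] := boolP (has (mem W) (u :: map snd p)); last first.
  (* When [p] misses [W], the empty path at any core vertex has the required empty edge set. *)
  exists x0, x0, [::]; split.
    by split=> //; rewrite /is_path /= Hx0 eqxx.
  apply/eqP; rewrite eq_sym [walk_edges [::]](_ : _ = set0); last first.
    by apply/setP=> f; rewrite !inE.
  rewrite setI_eq0; apply: (walk_edges_outside Wp).
  by move: HasW; rewrite /= negb_or => /andP[_ ->]; rewrite orbT.
have [x [a [r [Ep Wa Wr Hx Ha]]]] := walk_first Wp HasW.
have HasW' : has (mem W) (x :: map snd r) by rewrite /= Hx.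
have [y [b [c [Er Wb Wc Hy Hc]]]] := walk_last Wr HasW'.
have Hb : is_path g x y b.
  rewrite /is_path Wb; move: Hp; rewrite Ep (is_path_uniq Wa Wr) Er.
  rewrite map_cat -cat_cons cat_uniq cat_uniq.
  by case/and3P=> _ _ /and3P[].
(* The segment [b] contracts to a closed reduced walk at [None], which is empty; so every edge of
   [b] was dropped as a core edge. *)
have HbC : map fst b \subset edges C.
  have := walk_contract Wb; rewrite !contract_vertex_in // => Wb'.
  have := closed_reduced_nil acyclic_P Wb' (contract_walk_reduced Hb).
  move/(congr1 (@walk_edges _ _)); rewrite walk_edges_contract => /setP Eb.
  apply/subsetP=> f Hf; have := Eb f; rewrite !inE Hf andbT.
  by move/negbFE.
have HCb : walk C x y b by apply: walk_to_induced.
exists x, y, b; split; last first.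
  rewrite Ep Er !walk_edges_cat !setIUl.
  have /disjoint_setI0 -> : [disjoint walk_edges a & edges C].
    by apply: (walk_edges_outside Wa); rewrite Ha.
  have /disjoint_setI0 -> : [disjoint walk_edges c & edges C].
    by apply: (walk_edges_outside Wc); rewrite Hc orbT.
  rewrite set0U setU0; apply/esym/setIidPl/subsetP=> f; rewrite inE.
  exact: subsetP HbC f.
split; first by rewrite /is_path HCb; case/andP: Hb.
move=> q /andP[HCq Uq]; have Wq := walk_from_induced HCq.
(* Minimality of [p] against the path with [b] replaced by [q] yields the bound, as [a] and [c]
   contribute equally to both lengths. *)
suff /Hmin : is_path g u v (a ++ q ++ c).
  by rewrite Ep Er !size_cat leq_add2l leq_add2r.
have Vq := walk_induced_verts HCq.
move: Hp; rewrite Ep Er (is_path_uniq Wa (walk_cat Wb Wc)).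
rewrite (is_path_uniq Wa (walk_cat Wq Wc)) !map_cat -!cat_cons.
(* The vertices [sq] lie in [W] while [sa] and [sc] avoid it; that [sa] and [sc] share no vertex is
   inherited from [p]. *)
move: (belast _ _) (map snd c) (x :: map snd b) (x :: map snd q) Uq Vq Ha Hc.
move=> sa sc sb sq Uq Vq Ha Hc; rewrite !cat_uniq !has_cat !negb_or Uq.
case/and5P=> -> /andP[_ ->] _ _ ->; rewrite !andbT /=; apply/andP; split.
  by apply: contra Ha => /hasP[z /(allP Vq) Hz Hza]; apply/hasP; exists z.
by apply: contra Hc => /hasP[z Hzc /(allP Vq) Hz]; apply/hasP; exists z.
Qed.

End Contraction.

(** * Labellings with disjoint label sets *)

Section Labels.
Variables (E : finType) (U : Type).
Implicit Types (lab : E -> set U) (F S : {set E}).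

(** A label of an edge of [F] lies in [A], so only edges of [S] inside [F] can cover it. The set [F]
    is left general so that the lemma serves the core and, with [A] and [B] exchanged, the
    periphery. *)
Lemma no_false_positivesW F S0 S lab lab' (A B : set U) :
  (A `&` B = classical_sets.set0)%classic ->
  no_false_positives F lab S0 ->
  S0 = S :&: F ->
  (forall f, f \in F -> lab' f = lab f) ->
  (forall f, f \in F -> (lab f `<=` A)%classic) ->
  (forall f, f \in S :\: F -> (lab' f `<=` B)%classic) ->
  no_false_positives F lab' S.
Proof.
move=> AB Hnf ES0 Elab HA HB f [HfF HfS Hsub]; apply: (Hnf f); split=> //.
  by rewrite ES0 inE negb_and HfS.
move=> l Hl; have [|e /= HeS Hel] := Hsub l; first by rewrite Elab.
have [HeF|HeF] := boolP (e \in F).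
  by exists e; rewrite /= ?ES0 ?inE ?HeS // -Elab.
have : (A `&` B)%classic l.
  by split; [exact: HA Hl | apply: HB Hel; rewrite inE HeF].
by rewrite AB.
Qed.

End Labels.

Theorem proposition3 (T : finType) (E : {set {set T}})
  (hE : forall f : {set T}, f \in E -> #|f| = 2)
  (VC : {set T}) (hVC : VC != set0)
  (G : mgraph T {set T}) (hG : G = simple_graph E)
  (C : mgraph T {set T}) (hC : C = induced G VC)
  (P : mgraph (option T) {set T}) (hP : P = contract G VC)
  (htree : tree P)
  (U : Type) (A B : set U) (hAB : (A `&` B = classical_sets.set0)%classic)
  (labC labP : {set T} -> set U)
  (hlabC : forall f : {set T}, f \in edges C -> (labC f `<=` A)%classic)
  (hlabP : forall f : {set T}, f \in edges P -> (labP f `<=` B)%classic)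
  (hnfC : forall (u v : T) (p : seq ({set T} * T)),
     shortest_path C u v p ->
     no_false_positives (edges C) labC (walk_edges p))
  (hnfP : forall (u v : option T) (p : seq ({set T} * option T)),
     shortest_path P u v p ->
     no_false_positives (edges P) labP (walk_edges p)) :
  forall (u v : T) (p : seq ({set T} * T)),
    shortest_path G u v p ->
    no_false_positives (edges G) (combined_labelling (edges C) labC labP)
      (walk_edges p).
Proof.
move=> u v p Hp f [HfG HfS Hsub]; subst G.
have sVC : VC \subset verts (simple_graph E) by apply: subsetT.
have [_ acycP] := htree; rewrite hP in acycP.
have EP f' : f' \in E -> f' \notin edges C -> f' \in edges P.
  by move=> Hf' HfC; rewrite hP in_setD -hC HfC.
have sPE : walk_edges p \subset E by case: Hp => /andP[/walk_edgesS].
(* A false positive [f] is refuted in the part of the graph to which it belongs. *)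
have [HfC|HfC] := boolP (f \in edges C).
  have [x [y [q [Hq Eq]]]] := shortest_path_induced sVC acycP hVC Hp.
  rewrite -hC in Hq Eq.
  suff Hnf : no_false_positives (edges C) (combined_labelling (edges C) labC labP)
    (walk_edges p) by apply: (Hnf f).
  apply: (no_false_positivesW hAB (hnfC _ _ _ Hq) Eq _ hlabC).
    by move=> e; rewrite /combined_labelling => ->.
  move=> e /setDP[HeS HeC]; rewrite /combined_labelling (negPf HeC).
  exact/hlabP/EP/HeC/(subsetP sPE).
(* For a periphery edge the roles of [A] and [B] are swapped, hence the commuted intersection. *)
have Hq := shortest_path_contract acycP (proj1 Hp).
rewrite -hP in Hq; rewrite classical_sets.setIC in hAB.
have PC e : e \in edges P -> e \notin edges C.
  by rewrite hP hC in_setD => /andP[].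
suff Hnf : no_false_positives (edges P) (combined_labelling (edges C) labC labP)
  (walk_edges p) by apply: (Hnf f); split=> //; apply: EP.
apply: (no_false_positivesW hAB (hnfP _ _ _ Hq) _ _ hlabP).
- rewrite walk_edges_contract; apply/setP=> e; rewrite hP !in_setI !in_setD andbC.
  case: (boolP (e \in walk_edges p)) => //= /(subsetP sPE) He.
  by rewrite -[e \in edges (simple_graph E)]/(e \in E) He andbT.
- by move=> e /PC HeC; rewrite /combined_labelling (negPf HeC).
move=> e /setDP[/(subsetP sPE) HeE HeP].
have HeC : e \in edges C by apply: contraR HeP; apply: EP.
by rewrite /combined_labelling HeC; apply: hlabC.
Qed.
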